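(* Let $m,n\in\mathbb{N}$ with $2m\le n-2$. If $m\ge \log_2(n)$, then among all subdivided double stars on $n$ vertices with $2m$ leaves, the balanced subdivided double star (i.e. the baton) $D_n(m,m)$ is optimal.
   Context: The order of a graph is its number of vertices. A subtree of a tree $T$ is a nonempty connected subgraph. The mean subtree order $M_T$ is the average of the orders of all subtrees of $T$. A tree of maximum mean subtree order in a given family is called optimal in that family. For positive integers $n,r,s$ with $r+s\le n-2$, the subdivided double star $D_n(r,s)$ is the tree of order $n$ obtained by joining a vertex of degree $r$ in the star $K_{1,r}$ and a vertex of degree $s$ in the star $K_{1,s}$ by a path of order $n-r-s-2$ (each end of this path is made adjacent to one of the two star centres; if $n-r-s-2=0$, the two centres are simply joined by an edge). It has $r+s$ leaves, so the subdivided double stars on $n$ vertices with $2m$ leaves are the trees $D_n(s,2m-s)$ with $1\le s\le 2m-1$. A subdivided double star of the form $D_n(s,s)$ is called balanced, or a baton. *)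

(* Defs.v *)
From HB Require Import structures.
From mathcomp Require Import all_boot all_order all_algebra.
From mathcomp Require Import reals exp.

Set Implicit Arguments.
Unset Strict Implicit.
Unset Printing Implicit Defensive.

Import Order.TTheory GRing.Theory Num.Theory.
Local Open Scope ring_scope.

Record sgraph := SGraph {
  vertex :> finType;
  adj : rel vertex;
  adj_sym : symmetric adj;
  adj_irrefl : irreflexive adj }.

Arguments adj {s}.

Definition graph_order (G : sgraph) : nat := #|G|.

Definition edges (G : sgraph) : {set {set G}} :=
  [set e | [exists x, exists y, adj x y && (e == [set x; y])]].

Definition degree (G : sgraph) (x : G) : nat := #|[set y | adj x y]|.

Definition leaves (G : sgraph) : {set G} := [set x | degree x == 1%N].

Definition isomorphic (G H : sgraph) : Prop :=
  exists2 f : G -> H, bijective f & forall x y, adj (f x) (f y) = adj x y.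

(* A subgraph, not necessarily induced, is a pair (vertex set, edge set). *)
Definition is_subgraph (G : sgraph) (H : {set G} * {set {set G}}) : bool :=
  (H.2 \subset edges G) && [forall e in H.2, e \subset H.1].

(* A path along edges of a subgraph that starts in H.1 stays in H.1. *)
Definition is_connected (G : sgraph) (H : {set G} * {set {set G}}) : bool :=
  [forall x in H.1, forall y in H.1,
     connect (fun u v : G => [set u; v] \in H.2) x y].

Definition subtrees (G : sgraph) : {set {set G} * {set {set G}}} :=
  [set H | [&& is_subgraph H, is_connected H & H.1 != set0]].

Definition mean_subtree_order (G : sgraph) : rat :=
  (\sum_(H in subtrees G) #|H.1|%:R) / #|subtrees G|%:R.

Definition optimal (family : sgraph -> Prop) (T : sgraph) : Prop :=
  family T /\
  forall T' : sgraph, family T' -> mean_subtree_order T' <= mean_subtree_order T.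

(* Vertices of D_n(r, s): the n - r - s vertices of the path from one star
   centre (0) to the other (n - r - s - 1), both centres included, then the r
   leaves at the first centre and the s leaves at the second. *)
Definition dstar_vertex (n r s : nat) : finType :=
  ('I_(n - r - s) + ('I_r + 'I_s))%type.

Definition dstar_adj (n r s : nat) : rel (dstar_vertex n r s) :=
  fun x y =>
  match x, y with
  | inl i, inl j => (i.+1 == j :> nat) || (j.+1 == i :> nat)
  | inl i, inr (inl _) | inr (inl _), inl i => i == 0%N :> nat
  | inl i, inr (inr _) | inr (inr _), inl i => i.+1 == (n - r - s)%N :> nat
  | inr _, inr _ => false
  end.

Lemma dstar_adj_sym n r s : symmetric (@dstar_adj n r s).
Proof. by move=> [i|[a|b]] [j|[c|d]] //=; rewrite orbC. Qed.

Lemma dstar_adj_irrefl n r s : irreflexive (@dstar_adj n r s).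
Proof. by move=> [i|[a|b]] //=; rewrite orbb -[X in _ == X]addn0 -addn1 eqn_add2l. Qed.

(* The intended range is 0 < r, 0 < s and r + s + 2 <= n. *)
Definition dstar (n r s : nat) : sgraph :=
  SGraph (@dstar_adj_sym n r s) (@dstar_adj_irrefl n r s).

Definition subdivided_double_star (T : sgraph) : Prop :=
  exists n r s : nat,
    [/\ (0 < r)%N, (0 < s)%N, (r + s + 2 <= n)%N & isomorphic T (dstar n r s)].

Definition log2 (R : realType) (x : R) : R := ln x / ln 2.

(* Main.v *)
Require Import Defs.
From HB Require Import structures.
From mathcomp Require Import all_boot all_order all_algebra.
From mathcomp Require Import reals exp.
From mathcomp Require Import ring lra zify.

(** Let k be the number of path vertices of D_n(r, s), the two star centres
    included.  A subtree is either a single leaf, or an interval [i, j] of the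
    path together with a set A of left leaves, which must be empty unless i is
    the first centre, and a set B of right leaves, which must be empty unless j
    is the last one ([subtrees_dstar]).  Summing over these data gives, with
    r + s = 2m, the number N and the total order W of the subtrees
    ([sum_subtrees_dstar]):

      N = B + (k-1) S,   W = A + (k-1) ((k+m) S + D) / 2,

    where S = 2^r + 2^s, and, for r = m + d and s = m - d, D = d (2^r - 2^s);
    A and B depend on k and m only, because 2^r 2^s = 4^m.

    Unbalancing the leaves increases S, which adds many subtrees that stop
    short of one end of the path.  These have average order about (k+m)/2,
    whereas A / B is close to k + m, the average over the 4^m subtrees that
    contain the whole path; so a larger S pulls the mean down.  The only gain is
    D.  Cross-multiplying the two means and dividing by the common factors shows
    that, for d >= 1, the baton is at least as good exactly when

      d (2^d + 1) (B + 2 (k-1) 2^m) <= (2^d - 1) (2 A - (k+m) B)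

    ([balance_gap], [cross_le]).  Now d (2^d + 1) <= (d + 2) (2^d - 1), and
    d + 2 <= m + 1 because both centres have a leaf, so it suffices to compare
    (m + 1) (4^m + ...) with (k + m) 4^m - ..., where k >= 2.  The hypothesis
    n <= 2^m makes the omitted terms small enough once m >= 5.  For smaller m it
    leaves 10 <= n <= 16 with m = 4, where the same comparison holds, and n = 8
    with m = 3, where it fails but the inequality before it holds. *)

Set Implicit Arguments.
Unset Strict Implicit.
Unset Printing Implicit Defensive.

Import Order.TTheory GRing.Theory Num.Theory.
Local Open Scope ring_scope.

(** * Subtrees of a graph *)

Lemma edges_adj (G : sgraph) (x y : G) : ([set x; y] \in edges G) = adj x y.
Proof.
rewrite inE; apply/existsP/idP => [[u /existsP[v /andP[uv /eqP e]]]|xy]; last first.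
  by exists x; apply/existsP; exists y; rewrite xy eqxx.
have: x \in [set u; v] by rewrite -e set21.
have: y \in [set u; v] by rewrite -e set22.
have: u \in [set x; y] by rewrite e set21.
have: v \in [set x; y] by rewrite e set22.
have uv' : u != v by apply: contraTneq uv => ->; rewrite adj_irrefl.
rewrite !inE => /orP[]/eqP vE /orP[]/eqP uE _ _; subst u v; rewrite ?eqxx // in uv' *.
by rewrite adj_sym.
Qed.

Lemma subtree_edge (G : sgraph) (H : {set G} * {set {set G}}) (x y : G) :
  H \in subtrees G -> [set x; y] \in H.2 -> [/\ adj x y, x \in H.1 & y \in H.1].
Proof.
rewrite inE => /and3P[/andP[/subsetP sH /forall_inP eH] _ _] xy.
have /subsetP h := eH _ xy; rewrite -edges_adj sH //.
by split=> //; apply: h; rewrite ?set21 ?set22.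
Qed.

(** The way in which acyclicity is exploited: a subtree that meets both sides
    of a cut uses an edge across it, so if the graph has a single edge across the
    cut, the subtree contains that edge. *)
Lemma cut_edge (G : sgraph) (H : {set G} * {set {set G}}) (C : {set G}) (x y : G) :
    H \in subtrees G -> x \in H.1 -> y \in H.1 -> x \in C -> y \notin C ->
  exists u v, [/\ u \in C, v \notin C & [set u; v] \in H.2].
Proof.
rewrite inE => /and3P[_ /forall_inP cH _] xH yH.
move: (cH x xH) => /forall_inP/(_ y yH)/connectP[p].
elim: p x {xH} => [|z p IH] x /=; first by move=> _ -> ->.
case/andP=> xz zp ey xC yC; case: (boolP (z \in C)) => [zC|zC]; first exact: (IH z).
by exists x, z.
Qed.

Definition induced (G : sgraph) (V : {set G}) : {set G} * {set {set G}} :=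
  (V, [set e in edges G | e \subset V]).

(** Connectedness only has to be checked from one vertex, inside the graph
    with its adjacency relation restricted to V. *)
Lemma induced_subtree (G : sgraph) (V : {set G}) (c : G) :
    c \in V ->
    {in V, forall x, connect (fun u v : G => [&& adj u v, u \in V & v \in V]) c x} ->
  induced V \in subtrees G.
Proof.
move=> cV conn; rewrite inE; apply/and3P; split; last by apply/set0Pn; exists c.
  apply/andP; split; first by apply/subsetP => e; rewrite inE => /andP[].
  by apply/forall_inP => e; rewrite inE => /andP[].
have E : (fun u v : G => [set u; v] \in (induced V).2) =2
         (fun u v : G => [&& adj u v, u \in V & v \in V]).
  by move=> u v; rewrite inE edges_adj subUset !sub1set.
apply/forall_inP => x xV; apply/forall_inP => y yV; rewrite (eq_connect E).
apply: connect_trans (conn y yV); rewrite (sym_connect_sym _) ?conn // => u v.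
by rewrite adj_sym; congr (_ && _); rewrite andbC.
Qed.

(** * Invariance under isomorphism *)

Definition map_sub (G H : sgraph) (f : G -> H) (K : {set G} * {set {set G}}) :=
  (f @: K.1, (fun e : {set G} => f @: e) @: K.2).

Lemma map_subK (G H : sgraph) (f : G -> H) (g : H -> G) :
  cancel f g -> cancel (map_sub f) (map_sub g).
Proof.
move=> fK [V E]; have K (A : {set G}) : g @: (f @: A) = A.
  by rewrite -imset_comp (eq_imset _ (fK : g \o f =1 id)) imset_id.
rewrite /map_sub /= K -imset_comp; congr (_, _).
by rewrite (eq_imset _ (K : _ =1 id)) imset_id.
Qed.

Lemma map_sub_subtree (G H : sgraph) (f : G -> H) (K : {set G} * {set {set G}}) :
    (forall x y, adj (f x) (f y) = adj x y) -> K \in subtrees G ->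
  map_sub f K \in subtrees H.
Proof.
move=> fadj; rewrite !inE => /and3P[/andP[/subsetP sK /forall_inP eK] /forall_inP cK K0].
apply/and3P; split.
- apply/andP; split.
    apply/subsetP => _ /imsetP[e eK2 ->]; have := sK e eK2; rewrite inE.
    case/existsP=> x /existsP[y /andP[xy /eqP ->]].
    by rewrite imsetU !imset_set1 edges_adj fadj.
  by apply/forall_inP => _ /imsetP[e eK2 ->]; apply: imsetS; apply: eK.
- apply/forall_inP => _ /imsetP[x xK ->]; apply/forall_inP => _ /imsetP[y yK ->].
  move/forall_inP: (cK x xK) => /(_ y yK)/connectP[p pp ->] {yK}.
  apply/connectP; exists (map f p); last by rewrite last_map.
  rewrite path_map; apply: sub_path pp => u v uv /=.
  by rewrite -!imset_set1 -imsetU; apply: imset_f.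
- by case/set0Pn: K0 => x xK; apply/set0Pn; exists (f x); apply: imset_f.
Qed.

Lemma iso_sum_subtrees (G H : sgraph) (F : nat -> rat) :
    isomorphic G H ->
  \sum_(K in subtrees G) F #|K.1| = \sum_(K in subtrees H) F #|K.1|.
Proof.
case=> f [g fK gK] fadj.
have gadj x y : adj (g x) (g y) = adj x y by rewrite -fadj !gK.
rewrite [RHS](reindex (map_sub f)) /=; last first.
  by apply: onW_bij; exists (map_sub g); apply: map_subK.
apply: eq_big => [K|K _]; last by rewrite card_imset //; apply: can_inj fK.
apply/idP/idP; first exact: map_sub_subtree.
by move/(map_sub_subtree gadj); rewrite map_subK.
Qed.

Lemma mean_subtree_orderE (G : sgraph) :
  mean_subtree_order G =
  (\sum_(K in subtrees G) #|K.1|%:R) / \sum_(K in subtrees G) 1.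
Proof. by rewrite /mean_subtree_order sumr_const. Qed.

Lemma iso_mean_subtree_order (G H : sgraph) :
  isomorphic G H -> mean_subtree_order G = mean_subtree_order H.
Proof.
move=> GH; rewrite !mean_subtree_orderE.
by rewrite (@iso_sum_subtrees _ _ (fun i => i%:R) GH) (@iso_sum_subtrees _ _ (fun=> 1) GH).
Qed.

Lemma iso_order (G H : sgraph) : isomorphic G H -> graph_order G = graph_order H.
Proof. by case=> f /bij_eq_card ? _. Qed.

Lemma iso_leaves (G H : sgraph) : isomorphic G H -> #|leaves G| = #|leaves H|.
Proof.
case=> f bf fadj; have fI := bij_inj bf; case: bf => g fK gK.
have dE x : degree (f x) = degree x.
  rewrite /degree -[RHS](card_imset _ fI); apply: eq_card => y.
  rewrite inE; apply/idP/imsetP => [xy|[z]]; last by rewrite inE => xz ->; rewrite fadj.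
  by exists (g y); rewrite ?gK // inE -fadj gK.
rewrite -[LHS](card_imset _ fI); apply: eq_card => y.
rewrite inE; apply/imsetP/idP => [[z]|yl]; first by rewrite inE => xz ->; rewrite dE.
by exists (g y); rewrite ?gK // inE -dE gK.
Qed.

(** * The subtrees of a subdivided double star *)

(** Either one leaf, or the two ends of an interval of the path with the leaves
    attached on each side. *)
Definition subtree_code (n r s : nat) : finType :=
  (('I_r + 'I_s) +
   ('I_(n - r - s) * 'I_(n - r - s)) * ({set 'I_r} * {set 'I_s}))%type.

Definition dstar_set (n r s : nat) (i j : 'I_(n - r - s)) (A : {set 'I_r}) (B : {set 'I_s}) :
    {set dstar n r s} :=
  [set x : dstar_vertex n r s | match x with
     | inl t => (i <= t <= j)%N | inr (inl a) => a \in A | inr (inr b) => b \in B end].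

Definition decode (n r s : nat) (c : subtree_code n r s) : {set dstar n r s} :=
  match c with
  | inl l => [set (inr l : dstar n r s)]
  | inr (i, j, (A, B)) => dstar_set i j A B
  end.

Definition valid (n r s : nat) (c : subtree_code n r s) : bool :=
  match c with
  | inl _ => true
  | inr (i, j, (A, B)) =>
    [&& (i <= j)%N, (i == 0%N :> nat) || (A == set0) &
        (j.+1 == (n - r - s)%N :> nat) || (B == set0)]
  end.

Lemma decode_inj (n r s : nat) :
  {in [set c : subtree_code n r s | valid c] &, injective (@decode n r s)}.
Proof.
have not_leaf (i j : 'I_(n - r - s)) (A : {set 'I_r}) (B : {set 'I_s}) l :
    (i <= j)%N -> dstar_set i j A B = [set (inr l : dstar n r s)] -> False.
  by move=> ij /setP/(_ (inl i)); rewrite !inE leqnn ij.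
move=> [l|[[i j] [A B]]] [l'|[[i' j'] [A' B']]]; rewrite !inE.
- by move=> _ _ /set1_inj[->].
- by move=> _ /= /and3P[ij _ _] /esym/(not_leaf _ _ _ _ _ ij).
- by move=> /= /and3P[ij _ _] _ /(not_leaf _ _ _ _ _ ij).
move=> /= /and3P[ij _ _] /and3P[ij' _ _] /setP E.
have -> : A = A' by apply/setP => a; have := E (inr (inl a)); rewrite !inE.
have -> : B = B' by apply/setP => b; have := E (inr (inr b)); rewrite !inE.
have := E (inl i); have := E (inl j); have := E (inl i'); have := E (inl j').
rewrite !inE !leqnn ij ij' /= => /andP[? ?] /andP[? ?] /esym/andP[? ?] /esym/andP[? ?].
by congr (inr (_, _, _)); apply/val_inj/eqP; rewrite eqn_leq; apply/andP.
Qed.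

Lemma decode_subtree (n r s : nat) (c : subtree_code n r s) :
  valid c -> induced (decode c) \in subtrees (dstar n r s).
Proof.
case: c => [l _|[[i j] [A B]] /= /and3P[ij iA jB]].
  by apply: (@induced_subtree (dstar n r s) [set inr l] (inr l)) => [|x]; rewrite inE // => /eqP ->.
set V := dstar_set i j A B.
apply: (@induced_subtree (dstar n r s) V (inl i)); first by rewrite inE leqnn ij.
have path_conn (t : 'I_(n - r - s)) : (i <= t <= j)%N ->
    connect (fun u v : dstar n r s => [&& adj u v, u \in V & v \in V]) (inl i) (inl t).
  case: t; elim=> [|t IH] tk /andP[it tj].
    by rewrite (_ : i = Ordinal tk) //; apply: val_inj; move: it; rewrite /= leqn0 => /eqP.
  have [e|ne] := eqVneq (i : nat) t.+1; first by rewrite (_ : i = Ordinal tk) //; apply: val_inj.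
  have it' : (i <= t <= j)%N by move: it tj ne => /=; lia.
  apply: connect_trans (IH (ltnW tk) it') (connect1 _).
  by rewrite !inE it' /= eqxx; move: it tj => /= -> ->.
case=> [t|[a|b]]; rewrite inE; first exact: path_conn.
- move=> aA; case/orP: iA => [i0|/eqP A0]; last by rewrite A0 inE in aA.
  by apply: connect1; rewrite !inE aA leqnn ij /= i0.
- move=> bB; case/orP: jB => [jk|/eqP B0]; last by rewrite B0 inE in bB.
  apply: connect_trans (path_conn j _) (connect1 _); first by rewrite ij leqnn.
  by rewrite !inE bB leqnn ij /= jk.
Qed.

(** The edge from t to t + 1 is the only one across the cut that separates the
    left leaves and the path up to t from the rest. *)
Lemma subtree_path_step (n r s : nat) (H : {set dstar n r s} * {set {set dstar n r s}})
    (i j t t' : 'I_(n - r - s)) :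
    H \in subtrees (dstar n r s) -> inl i \in H.1 -> inl j \in H.1 ->
    (i <= t < j)%N -> t' = t.+1 :> nat ->
  [set (inl t : dstar n r s); inl t'] \in H.2.
Proof.
move=> HT iH jH /andP[it tj] t'E.
pose C : {set dstar n r s} :=
  [set x : dstar_vertex n r s | match x with inl p => (p <= t)%N | inr (inl _) => true | _ => false end].
have [||u [v [uC vC uv]]] := @cut_edge _ _ C (inl i) (inl j) HT iH jH.
- by rewrite inE.
- by rewrite inE -ltnNge.
have [uv' _ _] := subtree_edge HT uv.
have tk : (t.+1 < n - r - s)%N by rewrite -t'E.
case: u v uC vC uv uv' => [p|[a|b]] [q|[a'|b']]; rewrite !inE //= => pt tq uv pq.
- suff [<- <-] : p = t /\ q = t' by [].
  by split; apply: val_inj; move: pt tq pq t'E => /=; lia.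
- by move: pq pt tk => /eqP; lia.
- by move: pq tq => /eqP ->.
Qed.

(** The cut here is the one around l alone. *)
Lemma subtree_leaf_edge (G : sgraph) (H : {set G} * {set {set G}}) (l c x : G) :
    H \in subtrees G -> (forall y, adj l y -> y = c) ->
    l \in H.1 -> x \in H.1 -> x != l ->
  [set l; c] \in H.2.
Proof.
move=> HT lc lH xH xl.
have [||u [v [uC vC uv]]] := @cut_edge _ _ [set l] l x HT lH xH.
- by rewrite inE.
- by rewrite inE.
move: uC uv; rewrite inE => /eqP -> lv.
by have [/lc <-] := subtree_edge HT lv.
Qed.

(** Every edge of a double star is the only edge across some cut, so a subtree
    contains all the edges between its vertices, and is determined by them. *)
Lemma subtree_induced (n r s : nat) (H : {set dstar n r s} * {set {set dstar n r s}}) :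
  H \in subtrees (dstar n r s) -> H = induced H.1.
Proof.
move=> HT; rewrite /induced [LHS]surjective_pairing; congr (_, _); apply/setP => e.
rewrite [RHS]inE; apply/idP/andP => [eH|[]].
  by move: HT; rewrite inE => /and3P[/andP[/subsetP sH /forall_inP h] _ _]; rewrite sH ?h.
rewrite inE => /existsP[x /existsP[y /andP[xy /eqP ->]]].
rewrite subUset !sub1set => /andP[].
(* Orient the edge from left to right along the path, and from leaf to centre. *)
wlog: x y xy / match x, y with
    | inl i, inl j => (i < j)%N | inl _, inr _ => false | _, _ => true end => [wl xH yH|].
  case: x y xy xH yH => [p|[a|b]] [q|[a'|b']] // xy xH yH; try exact: (wl _ _ xy);
    try by rewrite setUC; apply: wl => //; rewrite adj_sym.
  move: (xy) => /orP[]/eqP pq; first by apply: (wl _ _ xy) => //; rewrite -pq.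
  by rewrite setUC; apply: (wl (inl q)) => //; [rewrite adj_sym | rewrite -pq].
case: x y xy => [p|l] [q|l'] // xy pq xH yH.
- move: (xy) pq => /orP[]/eqP pq pq'; last by move: pq pq'; lia.
  by apply: (subtree_path_step HT xH yH) => //; rewrite leqnn.
- apply: (subtree_leaf_edge HT _ xH yH) => // y ly.
  case: l y xy ly {xH yH} => [a|b] [t|[a'|b']] //= /eqP qE /eqP tE;
    by congr inl; apply: val_inj; move: qE tE => /=; lia.
- by case: l xy {xH pq} => a; case: l' {yH}.
Qed.

Lemma subtree_leaf_center (n r s : nat) (H : {set dstar n r s} * {set {set dstar n r s}})
    (l : 'I_r + 'I_s) (x : dstar n r s) :
    H \in subtrees (dstar n r s) -> (1 < n - r - s)%N ->
    inr l \in H.1 -> x \in H.1 -> x != inr l ->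
  exists2 t : 'I_(n - r - s), inl t \in H.1 & adj (inr l : dstar n r s) (inl t).
Proof.
move=> HT k1 lH xH xl.
have k0 : (0 < n - r - s)%N by lia.
have km : ((n - r - s).-1 < n - r - s)%N by lia.
pose t := if l is inl _ then Ordinal k0 else Ordinal km.
exists t; last by rewrite /t; case: l {lH xl t} => [a|b] //=; rewrite prednK.
suff /(subtree_edge HT)[] : [set (inr l : dstar n r s); inl t] \in H.2 by [].
apply: (subtree_leaf_edge HT _ lH xH xl) => -[p|l']; last by rewrite /=; case: (l) => ?; case: (l').
rewrite /t; case: l {lH xl t} => [a|b] /= /eqP pE; congr inl; apply: val_inj => //=.
by move: pE => /=; lia.
Qed.

(** The interval runs from the least to the greatest path vertex of H, and has
    no gap by [subtree_path_step]; a leaf brings its centre along, which is then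
    the extremal path vertex. *)
Lemma subtree_decode (n r s : nat) (H : {set dstar n r s} * {set {set dstar n r s}}) :
    (1 < n - r - s)%N -> H \in subtrees (dstar n r s) ->
  exists2 c : subtree_code n r s, valid c & H.1 = decode c.
Proof.
move=> k1 HT.
have [x0 x0H] : exists x, x \in H.1 by move: HT; rewrite inE => /and3P[_ _ /set0Pn].
case: (pickP (fun t : 'I_(n - r - s) => inl t \in H.1)) => [t0 t0H|noP]; last first.
  case: x0 x0H => [t|l] lH; first by rewrite noP in lH.
  exists (inl l) => //; apply/setP => x; rewrite /= in_set1.
  apply/idP/eqP => [xH|-> //]; apply: contraTeq xH => xl; apply/negP => xH.
  by have [t tH _] := subtree_leaf_center HT k1 lH xH xl; rewrite noP in tH.
case: (@arg_minnP _ t0 (fun t => inl t \in H.1) (@nat_of_ord (n - r - s)) t0H) => i iH imin.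
case: (@arg_maxnP _ t0 (fun t => inl t \in H.1) (@nat_of_ord (n - r - s)) t0H) => j jH jmax.
pose A := [set a | (inr (inl a) : dstar n r s) \in H.1].
pose B := [set b | (inr (inr b) : dstar n r s) \in H.1].
have ij : (i <= j)%N by apply: leq_trans (imin _ t0H) (jmax _ t0H).
exists (inr (i, j, (A, B))) => /=.
  rewrite ij /=; apply/andP; split; rewrite orbC -implyNb; apply/implyP => /set0Pn[a];
    rewrite inE => aH.
    have [//|t /imin it /= /eqP tz] := subtree_leaf_center HT k1 aH t0H _.
    by move: it; rewrite tz leqn0.
  have [//|t /jmax jt /= /eqP tk] := subtree_leaf_center HT k1 aH t0H _.
  by apply/eqP; have := ltn_ord j; move: jt tk => /=; lia.
apply/setP => -[t|[a|b]]; rewrite [RHS]inE ?[RHS]inE //.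
apply/idP/andP => [tH|[it tj]]; first by split; [apply: imin|apply: jmax].
move: it; rewrite leq_eqVlt => /orP[/eqP it|it]; first by rewrite -(val_inj it).
have t1k : (t.-1 < n - r - s)%N by apply: leq_ltn_trans (ltn_ord t); lia.
have [||] // := subtree_edge HT (@subtree_path_step _ _ _ H i j (Ordinal t1k) t HT iH jH _ _).
- by move: it tj => /=; lia.
- by move: it => /=; lia.
Qed.

Lemma subtrees_dstar (n r s : nat) :
    (1 < n - r - s)%N ->
  subtrees (dstar n r s) = [set induced (decode c) | c in [set c : subtree_code n r s | valid c]].
Proof.
move=> k1; apply/setP => H; apply/idP/imsetP => [HT|[c]]; last first.
  by rewrite inE => /decode_subtree ? ->.
by have [c vc cE] := subtree_decode k1 HT; exists c; rewrite ?inE // -cE -subtree_induced.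
Qed.

(** * Sums of affine functions of the order *)

(** Isolates the intervals that contain neither end, only the first vertex,
    only the last vertex, and the whole path.  In the first and third sums the
    left end is shifted by one. *)
Lemma sum_triangle_border (K : nat) (f : nat -> nat -> rat) :
  \sum_(i < K.+1) \sum_(j < K.+1 | (i <= j)%N) f i j =
  \sum_(i < K) \sum_(j < K | (i < j)%N) f i.+1 j + \sum_(j < K) f 0%N j
  + \sum_(i < K) f i.+1 K + f 0%N K.
Proof.
rewrite big_ord_recl /= big_ord_recr /=.
rewrite [X in _ + X](eq_bigr (fun i : 'I_K => \sum_(j < K | (i < j)%N) f i.+1 j + f i.+1 K)).
  rewrite big_split /=; ring.
move=> i _; rewrite !big_mkcond big_ord_recr /= /bump /= add1n ltn_ord.
by rewrite -big_mkcond.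
Qed.

Lemma sum_lengths (K : nat) (u v : rat) :
  \sum_(j < K) (u + v * (j%:R + 1)) = K%:R * u + v * (K%:R * (K%:R + 1) / 2).
Proof.
elim: K => [|K IH]; first by rewrite big_ord0; ring.
by rewrite big_ord_recr /= IH -natr1; field.
Qed.

Lemma sum_lengths_rev (K : nat) (u v : rat) :
  \sum_(i < K) (u + v * (K%:R - i%:R)) = K%:R * u + v * (K%:R * (K%:R + 1) / 2).
Proof.
rewrite -sum_lengths [RHS](reindex_inj rev_ord_inj) /=; apply: eq_bigr => i _.
by congr (_ + _ * _); rewrite natrB // -natr1; ring.
Qed.

Lemma sum_inner_lengths (K : nat) (u v : rat) :
  \sum_(i < K) \sum_(j < K | (i < j)%N) (u + v * (j%:R - i%:R)) =
  u * (K%:R * (K%:R - 1) / 2) + v * ((K%:R + 1) * K%:R * (K%:R - 1) / 6).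
Proof.
elim: K => [|K IH]; first by rewrite big_ord0; ring.
rewrite big_ord_recr /= [X in _ + X]big_pred0; last by move=> j; have := ltn_ord j; lia.
rewrite addr0.
rewrite (eq_bigr (fun i : 'I_K => \sum_(j < K | (i < j)%N) (u + v * (j%:R - i%:R))
                                  + (u + v * (K%:R - i%:R)))).
  by rewrite big_split /= IH sum_lengths_rev -natr1; field.
by move=> i _; rewrite big_mkcond big_ord_recr /= ltn_ord -big_mkcond.
Qed.

(** Complementation shows that a subset contains r / 2 elements on average. *)
Lemma sum_affine_subsets (r : nat) (u v : rat) :
  \sum_(A : {set 'I_r}) (u + v * #|A|%:R) = 2 ^+ r * (u + v * (r%:R / 2)).
Proof.
set S := LHS.
have cs : \sum_(A : {set 'I_r}) (1 : rat) = 2 ^+ r.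
  by rewrite sumr_const -cardsT -powersetT card_powerset cardsT card_ord natrX.
suff : S + S = 2 ^+ r * (2 * u + v * r%:R) by move=> h; lra.
rewrite {1}/S (reindex_inj (@setC_inj _)) /= /S -big_split /= -cs mulr_suml.
apply: eq_bigr => A _; rewrite -[in r%:R](card_ord r) -(cardsC A) natrD; ring.
Qed.

Lemma sum_affine_subsets_cond (r : nat) (P : bool) (u v : rat) :
  \sum_(A : {set 'I_r} | P || (A == set0)) (u + v * #|A|%:R) =
  if P then 2 ^+ r * (u + v * (r%:R / 2)) else u.
Proof.
case: P => /=; first exact: sum_affine_subsets.
by rewrite big_pred1_eq cards0 mulr0 addr0.
Qed.

(** * Mean subtree order, order and leaves of a subdivided double star *)

Lemma card_interval (k i j : nat) :
  (i <= j < k)%N -> #|[pred t : 'I_k | (i <= t <= j)%N]| = (j.+1 - i)%N.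
Proof.
move=> /andP[ij jk]; rewrite -sum1_card -(big_mkord (fun t => (i <= t <= j)%N) (fun=> 1%N)).
rewrite -[RHS]muln1 -sum_nat_const_nat [RHS](big_nat_widen _ _ k) // [RHS](big_nat_widenl _ 0%N) //.
by apply: eq_bigl => t; rewrite ltnS andbC.
Qed.

Lemma card_dstar_set (n r s : nat) (i j : 'I_(n - r - s)) (A : {set 'I_r}) (B : {set 'I_s}) :
  (i <= j)%N -> #|dstar_set i j A B| = ((j.+1 - i) + (#|A| + #|B|))%N.
Proof.
move=> ij; rewrite -sum1_card big_sumType /= big_sumType /=.
rewrite -(card_interval (k := n - r - s)) ?ij //=.
by rewrite -!sum1_card; congr (_ + (_ + _))%N; apply: eq_bigl => t; rewrite !inE.
Qed.

Lemma sum_leaf_choices (r s : nat) (P Q : bool) (u v l : rat) :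
  \sum_(A : {set 'I_r} | P || (A == set0)) \sum_(B : {set 'I_s} | Q || (B == set0))
      (u + v * (l + #|A|%:R + #|B|%:R)) =
  (if P then 2 ^+ r else 1) * (if Q then 2 ^+ s else 1) *
  (u + v * (l + (if P then r%:R / 2 else 0) + if Q then s%:R / 2 else 0)).
Proof.
pose b : rat := if Q then 2 ^+ s else 1; pose h : rat := if Q then s%:R / 2 else 0.
rewrite (eq_bigr (fun A : {set 'I_r} => b * (u + v * (l + h)) + b * v * #|A|%:R)).
  by rewrite sum_affine_subsets_cond /b /h; case: P; case: (Q); ring.
move=> A _; rewrite (eq_bigr (fun B : {set 'I_s} => (u + v * (l + #|A|%:R)) + v * #|B|%:R)).
  by rewrite sum_affine_subsets_cond /b /h; case: (Q); ring.
by move=> B _; ring.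
Qed.

(** The four summands of each quantity come from the single leaves, the
    intervals that avoid both centres, those that contain exactly one centre, and
    the whole path; k is the number of path vertices. *)
Definition dstar_count (k r s : nat) : rat :=
  (r + s)%:R + (k%:R - 1) * (k%:R - 2) / 2 + (k%:R - 1) * (2 ^+ r + 2 ^+ s) + 2 ^+ r * 2 ^+ s.

Definition dstar_weight (k r s : nat) : rat :=
  (r + s)%:R + k%:R * (k%:R - 1) * (k%:R - 2) / 6
  + (k%:R - 1) * (2 ^+ r * ((k%:R + r%:R) / 2) + 2 ^+ s * ((k%:R + s%:R) / 2))
  + 2 ^+ r * 2 ^+ s * (k%:R + (r + s)%:R / 2).

(** The coefficients u and v serve to obtain the number of subtrees and their
    total order from one computation. *)
Lemma sum_subtrees_dstar (n r s : nat) (u v : rat) :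
    (1 < n - r - s)%N ->
  \sum_(H in subtrees (dstar n r s)) (u + v * #|H.1|%:R) =
  u * dstar_count (n - r - s) r s + v * dstar_weight (n - r - s) r s.
Proof.
move=> k1; rewrite subtrees_dstar // big_imset /=; last first.
  by move=> c c' vc vc' [/(decode_inj vc vc')].
under eq_bigl do rewrite inE; rewrite big_sumType /=.
under eq_bigr do rewrite cards1.
rewrite sumr_const cardT -cardE card_sum !card_ord.
have -> : \sum_(p | valid (inr p : subtree_code n r s))
      (u + v * #|decode (inr p : subtree_code n r s)|%:R) =
    \sum_(i < n - r - s) \sum_(j < n - r - s | (i <= j)%N)
      \sum_(A : {set 'I_r} | (i == 0%N :> nat) || (A == set0))
      \sum_(B : {set 'I_s} | (j.+1 == (n - r - s)%N :> nat) || (B == set0))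
        (u + v * (j%:R - i%:R + 1 + #|A|%:R + #|B|%:R)).
  rewrite pair_big_dep; under [RHS]eq_bigr do rewrite pair_big_dep.
  rewrite pair_big_dep; apply: eq_big => -[[i j] [A B]] //= /andP[ij _].
  by rewrite card_dstar_set // !natrD natrB 1?leqW // -natr1; ring.
under eq_bigr => i _ do under eq_bigr => j _ do rewrite sum_leaf_choices.
(* K counts the edges of the path. *)
case: (n - r - s)%N k1 => [//|K] _.
rewrite (@sum_triangle_border _ (fun i j => (if i == 0%N then 2 ^+ r else 1)
    * (if j.+1 == K.+1 then 2 ^+ s else 1)
    * (u + v * (j%:R - i%:R + 1 + (if i == 0%N then r%:R / 2 else 0)
                + if j.+1 == K.+1 then s%:R / 2 else 0)))) /= eqxx.
rewrite (eq_bigr (fun i : 'I_K => \sum_(j < K | (i < j)%N) (u + v * (j%:R - i%:R)))); last first.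
  move=> i _; apply: eq_bigr => j _; rewrite eqSS (ltn_eqF (ltn_ord j)) -natr1; ring.
rewrite sum_inner_lengths.
rewrite (eq_bigr (fun j : 'I_K => 2 ^+ r * ((u + v * (r%:R / 2)) + v * (j%:R + 1)))); last first.
  move=> i _; rewrite eqSS (ltn_eqF (ltn_ord i)); ring.
rewrite -mulr_sumr sum_lengths.
rewrite (eq_bigr (fun i : 'I_K => 2 ^+ s * ((u + v * (s%:R / 2)) + v * (K%:R - i%:R)))); last first.
  move=> i _; rewrite -natr1; ring.
rewrite -mulr_sumr sum_lengths_rev /dstar_count /dstar_weight !natrD -[K.+1%:R]natr1.
rewrite -[_ *+ (r + s)]mulr_natr natrD.
by field.
Qed.

Lemma mean_dstar (n r s : nat) :
    (1 < n - r - s)%N ->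
  mean_subtree_order (dstar n r s) = dstar_weight (n - r - s) r s / dstar_count (n - r - s) r s.
Proof.
move=> k1; rewrite mean_subtree_orderE; congr (_ / _).
  have := sum_subtrees_dstar 0 1 k1; rewrite mul0r add0r mul1r => <-.
  by apply: eq_bigr => H _; rewrite add0r mul1r.
have := sum_subtrees_dstar 1 0 k1; rewrite mul0r addr0 mul1r => <-.
by apply: eq_bigr => H _; rewrite mul0r addr0.
Qed.

Lemma order_dstar (n r s : nat) : (r + s <= n)%N -> graph_order (dstar n r s) = n.
Proof. by move=> h; rewrite /graph_order !card_sum !card_ord; lia. Qed.

Lemma leaves_dstar (n r s : nat) :
    (0 < r)%N -> (0 < s)%N -> (1 < n - r - s)%N ->
  #|leaves (dstar n r s)| = (r + s)%N.
Proof.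
move=> r0 s0 k1; have k0 : (0 < n - r - s)%N by lia.
have km : ((n - r - s).-1 < n - r - s)%N by lia.
pose G : sgraph := dstar n r s.
(* Leaves have a single neighbour; each path vertex is shown to have two. *)
have two (x y z : G) : y != z -> adj x y -> adj x z -> degree x != 1%N.
  move=> yz xy xz; apply/cards1P => -[w /setP E].
  have := E z; have := E y; rewrite !inE xy xz => /esym/eqP yw /esym/eqP zw.
  by rewrite yw zw eqxx in yz.
have one (x y : G) : (forall z, adj x z = (z == y)) -> degree x = 1%N.
  by move=> E; rewrite /degree -(cards1 y); apply: eq_card => z; rewrite !inE E.
have -> : leaves G = [set inr l | l in [set: 'I_r + 'I_s]].
  apply/setP => x; rewrite inE; apply/idP/imsetP => [|[l _ ->]].
    case: x => [t|l]; last by exists l; rewrite ?inE.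
    have t1 := ltn_ord t; move=> d1; suff /negP[] : degree (inl t : G) != 1%N by [].
    have [t0|tn0] := eqVneq (t : nat) 0%N.
      by apply: (two _ (inr (inl (Ordinal r0))) (inl (Ordinal k1))) => //=; rewrite ?t0.
    have tp : (t.-1 < n - r - s)%N by lia.
    have [tl|tl] := ltnP t.+1 (n - r - s)%N.
      apply: (two _ (inl (Ordinal tp)) (inl (Ordinal tl))) => /=; rewrite ?eqxx ?orbT //; last first.
        by apply/orP; right; apply/eqP; lia.
      by apply/eqP => -[]; lia.
    apply: (two _ (inl (Ordinal tp)) (inr (inr (Ordinal s0)))) => //=; apply/eqP; lia.
  pose t := if l is inl _ then Ordinal k0 else Ordinal km.
  apply/eqP/(one _ (inl t)); rewrite /t; case: l {t} => [a|b] [p|[a'|b']] //=.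
  by apply/eqP/eqP => [pE|[]->]; [congr inl; apply: val_inj => /=; lia|rewrite prednK].
by rewrite card_imset ?cardsT ?card_sum ?card_ord // => ? ? [].
Qed.

(** * Comparison of the means *)

(** The factor (2^d + 1) / (2^d - 1) is large for small d only.  The bound is
    attained at d = 1. *)
Lemma unbalance_factor (d : nat) :
  d%:R * (2 ^+ d + 1) <= (d%:R + 2) * (2 ^+ d - 1) :> rat.
Proof.
have : d%:R + 1 <= 2 ^+ d :> rat by rewrite -natrX natr1 ler_nat ltn_expl.
move=> h; nra.
Qed.

(** The first exponent for which this holds is 5, with equality; it marks the
    range in which the estimates of [balance_gap_large] suffice. *)
Lemma exp2_ge (m : nat) : (5 <= m)%N -> (4 * m + 12 <= 2 ^ m)%N.
Proof.
elim: m => // m IH; rewrite leq_eqVlt => /orP[/eqP [<-] //|/IH]; rewrite expnS; lia.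
Qed.

(** After expansion the claim is K q^2 >= 2 m (K + 2 m)
    + K (K - 1) (K + 6 m + 4) / 6 + 2 (m + 1) K q.  As K >= 1, the right-hand side
    is at most K times 2 m (1 + 2 m) + (K - 1) (K + 6 m + 4) / 6 + 2 (m + 1) q, and
    K < q - 2 m together with 4 m + 12 <= q bounds this cofactor by q^2. *)
Lemma balance_gap_large (m K q : rat) :
    5 <= m -> 1 <= K -> 4 * m + 12 <= q -> 2 * m + 1 + K <= q ->
  (m + 1) * (2 * m + K * (K - 1) / 2 + q ^+ 2 + 2 * K * q) <=
  2 * (2 * m + (K + 1) * K * (K - 1) / 6 + q ^+ 2 * (K + 1 + m))
  - (K + 1 + m) * (2 * m + K * (K - 1) / 2 + q ^+ 2).
Proof.
move=> m5 K1 qm qK.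
have a1 : 2 * m * (K + 2 * m) <= K * (2 * m * (1 + 2 * m)).
  have : 0 <= (m * m) * (K - 1) by apply: mulr_ge0; nra.
  by lra.
have a2 : (K - 1) * (K + 6 * m + 4) <= (q - 2 * m - 2) * (q + 4 * m + 3).
  by apply: ler_pM; lra.
have a3 : 6 * (2 * m * (1 + 2 * m)) + (K - 1) * (K + 6 * m + 4) + 12 * (m + 1) * q
          <= 6 * q ^+ 2.
  have : 0 <= (q - 4 * m - 12) * q by apply: mulr_ge0; lra.
  have : 0 <= (q - 4 * m - 12) * m by apply: mulr_ge0; lra.
  by nra.
have : 0 <= K * (6 * q ^+ 2
    - (6 * (2 * m * (1 + 2 * m)) + (K - 1) * (K + 6 * m + 4) + 12 * (m + 1) * q)).
  by apply: mulr_ge0; lra.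
by lra.
Qed.

(** The case m = 4, where q = 16 is too small for [balance_gap_large] but K is
    at most 7, so that the cubic term is at most a multiple of K - 1. *)
Lemma balance_gap_four (K : rat) :
    1 <= K -> K <= 7 ->
  (4 + 1) * (2 * 4 + K * (K - 1) / 2 + 16 ^+ 2 + 2 * K * 16) <=
  2 * (2 * 4 + (K + 1) * K * (K - 1) / 6 + 16 ^+ 2 * (K + 1 + 4))
  - (K + 1 + 4) * (2 * 4 + K * (K - 1) / 2 + 16 ^+ 2).
Proof.
move=> K1 K7.
have h1 : K * (K - 1) <= 7 * (K - 1) by apply: ler_pM; lra.
have h2 : K * (K - 1) * (K + 28) <= 7 * (K - 1) * 35 by apply: ler_pM; nra.
by lra.
Qed.

(** Here K is the number of edges of the path, so K = k - 1, and the bound on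
    2 ^ m says that it is at least the number of vertices. *)
Lemma balance_gap (m d K : nat) :
    (0 < K)%N -> (2 * m + 1 + K <= 2 ^ m)%N -> (0 < d < m)%N ->
  d%:R * (2 ^+ d + 1) * (2 * m%:R + K%:R * (K%:R - 1) / 2 + (2 ^+ m) ^+ 2 + 2 * K%:R * 2 ^+ m) <=
  (2 ^+ d - 1) *
  (2 * (2 * m%:R + (K%:R + 1) * K%:R * (K%:R - 1) / 6 + (2 ^+ m) ^+ 2 * (K%:R + 1 + m%:R))
  - (K%:R + 1 + m%:R) * (2 * m%:R + K%:R * (K%:R - 1) / 2 + (2 ^+ m) ^+ 2)) :> rat.
Proof.
move=> K0 Kq /andP[d0 dm].
have K1 : 1 <= K%:R :> rat by rewrite (ler_nat _ 1).
case: (leqP m 3) => [m3|m4].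
  (* The bound 2 m + 2 <= 2 ^ m excludes m <= 2; for m = 3 it forces K = 1, where
     d = 1 and d = 2 are checked by computation. *)
  case: m m3 Kq dm => [|[|[|[|m]]]] // _ Kq dm; rewrite ?expnS ?expn0 in Kq; try lia.
  have -> : K = 1%N by lia.
  by case: d d0 dm => [|[|[|]]].
have g :
    (m%:R + 1) * (2 * m%:R + K%:R * (K%:R - 1) / 2 + (2 ^+ m) ^+ 2 + 2 * K%:R * 2 ^+ m) <=
    2 * (2 * m%:R + (K%:R + 1) * K%:R * (K%:R - 1) / 6 + (2 ^+ m) ^+ 2 * (K%:R + 1 + m%:R))
    - (K%:R + 1 + m%:R) * (2 * m%:R + K%:R * (K%:R - 1) / 2 + (2 ^+ m) ^+ 2) :> rat.
  move: m4; rewrite leq_eqVlt => /orP[/eqP mE|m5].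
    have K7 : K%:R <= 7 :> rat by rewrite (ler_nat _ _ 7) -mE /= in Kq *; lia.
    have -> : 2 ^+ m = 16 :> rat by rewrite -mE.
    by rewrite -mE; apply: balance_gap_four.
  have qm := exp2_ge m5.
  apply: balance_gap_large => //; first by rewrite (ler_nat _ 5).
    by rewrite -natrX -natrM -natrD ler_nat.
  by have := Kq; rewrite -(ler_nat rat) natrD natrD natrM natrX.
set X := (X in _ * X <= _); set Y := (Y in _ <= _ * Y); rewrite -/X -/Y in g.
have X0 : 0 <= X.
  have q0 : 0 <= 2 ^+ m :> rat by rewrite exprn_ge0.
  have k0 : 0 <= K%:R - 1 :> rat by rewrite subr_ge0 (ler_nat _ 1).
  by rewrite /X; repeat first [exact: k0 | apply: addr_ge0 | apply: mulr_ge0 | apply: exprn_ge0].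
have p1 : 0 <= 2 ^+ d - 1 :> rat by rewrite subr_ge0 exprn_ege1 // (ler_nat _ 1 2).
have dm' : d%:R + 2 <= m%:R + 1 :> rat by rewrite -natrD natr1 ler_nat; lia.
apply: le_trans (ler_wpM2r X0 (unbalance_factor d)) _.
rewrite [_ * (_ - 1)]mulrC -mulrA ler_wpM2l //.
exact: le_trans (ler_wpM2r X0 dm') g.
Qed.

Lemma dstar_count_gt0 (k r s : nat) : (1 < k)%N -> 0 < dstar_count k r s.
Proof.
move=> k1; have h : 0 <= k%:R - 2 :> rat by rewrite subr_ge0 ler_nat.
have h' : 0 <= k%:R - 1 :> rat by lra.
apply: ltr_wpDl; last by rewrite mulr_gt0 ?exprn_gt0.
by repeat first [exact: h | exact: h' | apply: addr_ge0 | apply: mulr_ge0 | apply: exprn_ge0].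
Qed.

(** Put K = k - 1, d = m - s, b = 2^s and p = 2^d, so that 2^r = b p^2 and 2^m = b p, the difference
    of the two sides is K b (p - 1) / 2 times the difference of the two sides of
    [balance_gap]. *)
Lemma cross_le (k m s : nat) :
    (1 < k)%N -> (2 * m + k <= 2 ^ m)%N -> (0 < s <= m)%N ->
  dstar_weight k (2 * m - s) s * dstar_count k m m <=
  dstar_weight k m m * dstar_count k (2 * m - s) s.
Proof.
move=> k1 kq /andP[s0 sm]; have [d dE] : {d | (d + s)%N = m} by exists (m - s)%N; lia.
have -> : (2 * m - s)%N = (m + d)%N by lia.
have [d0|d0] := posnP d; first by rewrite d0 in dE *; rewrite -dE add0n addn0.
have g := @balance_gap m d (k - 1) ltac:(lia) ltac:(lia) ltac:(lia).
rewrite natrB ?(ltnW k1) // in g.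
have sE : s%:R = m%:R - d%:R :> rat by rewrite -dE natrD; ring.
have qE : 2 ^+ m = 2 ^+ d * 2 ^+ s :> rat by rewrite -exprD dE.
rewrite qE in g; rewrite /dstar_weight /dstar_count !(exprD, natrD) qE sE.
have b0 : 0 <= 2 ^+ s :> rat by rewrite exprn_ge0.
have p1 : 0 <= 2 ^+ d - 1 :> rat by rewrite subr_ge0 exprn_ege1 // (ler_nat _ 1 2).
have k0 : 0 <= k%:R - 1 :> rat by rewrite subr_ge0 (ler_nat _ 1); lia.
rewrite -subr_ge0 in g.
have := mulr_ge0 (mulr_ge0 (mulr_ge0 k0 b0) p1) g.
move: (2 ^+ s) (2 ^+ d) (k%:R) (m%:R) (d%:R) => b p x y z {}g.
have {}g := divr_ge0 g (ler0n _ 2); rewrite -subr_ge0.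
by apply: le_trans g _; rewrite le_eqVlt; apply/predU1l; field.
Qed.

Lemma dstar_weightC (k r s : nat) : dstar_weight k r s = dstar_weight k s r.
Proof. rewrite /dstar_weight addnC; ring. Qed.

Lemma dstar_countC (k r s : nat) : dstar_count k r s = dstar_count k s r.
Proof. rewrite /dstar_count addnC; ring. Qed.

Lemma le_exp2_log2 (R : realType) (m n : nat) :
  (0 < n)%N -> log2 (n%:R : R) <= m%:R -> (n <= 2 ^ m)%N.
Proof.
move=> n0; have l2 : 0 < ln 2 :> R by rewrite ln_gt0 ?ltr1n.
rewrite /log2 ler_pdivrMr // mulr_natl -lnXn // ler_ln ?posrE ?ltr0n ?exprn_gt0 //.
by rewrite -natrX ler_nat.
Qed.

Theorem theorem4p1 (R : realType) (m n : nat)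
    (hmn : (2 * m + 2 <= n)%N)
    (hlog : log2 (n%:R : R) <= m%:R) :
  optimal
    (fun T : sgraph =>
       [/\ subdivided_double_star T, graph_order T = n & #|leaves T| = (2 * m)%N])
    (dstar n m m).
Proof.
have nm : (n <= 2 ^ m)%N by apply: le_exp2_log2 hlog; lia.
have m0 : (0 < m)%N by case: (m) hmn nm => [|//]; lia.
split.
  split; last 1 first.
  - by rewrite leaves_dstar //; lia.
  - exists n, m, m; split=> //; first by lia.
    by exists id => //; exists id.
  - by rewrite order_dstar //; lia.
move=> T [[n' [r [s [r0 s0 rsn iso]]]] oT lT].
rewrite (iso_order iso) order_dstar in oT; last by lia.
rewrite (iso_leaves iso) leaves_dstar in lT; try lia.
rewrite (iso_mean_subtree_order iso) {iso T}; subst n'.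
rewrite !mean_dstar; try lia.
have -> : (n - r - s = n - m - m)%N by lia.
rewrite ler_pdivrMr ?dstar_count_gt0; try lia.
rewrite mulrAC ler_pdivlMr ?dstar_count_gt0; try lia.
wlog sm : r s r0 s0 rsn lT / (s <= m)%N => [wl|].
  have [sm|ms] := leqP s m; first exact: wl.
  by rewrite dstar_weightC dstar_countC; apply: wl => //; lia.
have -> : r = (2 * m - s)%N by lia.
by apply: cross_le; lia.
Qed.
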